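(* Let $\Delta_j$ ($j\in\mathbb{N}$) be graphs and $m\in\mathbb{N}\cup\{\infty\}$ with $\operatorname{wCop}(\Delta_j)\geq m$ for all $j$. Suppose moreover that for every $n\in\mathbb{N}$ with $n<m$ and all $\overline{\sigma},\overline{\rho}\in\mathbb{N}$ there exist $\overline{\psi},\overline{R}\in\mathbb{N}$ (independent of $j$) such that for every $j$, with respect to some base vertex of $\Delta_j$, the robber has a winning strategy against $n$ cops in the game on $\Delta_j$ with cop speed $\overline{\sigma}$, cop reach $\overline{\rho}$, robber speed $\overline{\psi}$ and robber radius $\overline{R}$. Let $A\geq 1$, $B\geq 0$, let $\rho=(\rho_j)_j$ be a sequence of positive integers with $\rho_j\to\infty$, let $\Gamma$ be a graph, and let $\iota_j\colon\Delta_j\to\Gamma$ be a sequence of $(A\rho+B)$-surjective $(A,B)$-quasi-$\rho$-homotheties. Then $\operatorname{sCop}(\Gamma)\geq m$.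
   Context: Quasi-homotheties. Let $A\geq 1$, $B\geq 0$, $\rho=(\rho_j)_j$ a sequence of positive integers with $\rho_j\to\infty$, and $\Gamma$, $\Delta_j$ ($j\in\mathbb{N}$) graphs. A collection of maps $\iota_j\colon\Delta_j\to\Gamma$ (between vertex sets) is a sequence of $(A\rho+B)$-surjective $(A,B)$-quasi-$\rho$-homotheties if for all $j\in\mathbb{N}$: (1) for every $x\in\Gamma$ there is $\overline{x}\in\Delta_j$ with $d_\Gamma(\iota_j(\overline{x}),x)\leq A\rho_j+B$; (2) for all $\overline{x},\overline{y}\in\Delta_j$, $A^{-1}d_{\Delta_j}(\overline{x},\overline{y})-B\leq\frac{1}{\rho_j}d_\Gamma(\iota_j(\overline{x}),\iota_j(\overline{y}))\leq A\,d_{\Delta_j}(\overline{x},\overline{y})+B$. Convention: $\mathbb{N}=\mathbb{Z}_{\geq 1}$. Graphs are connected, undirected, without double edges or loops, with the path metric on vertices. Game. Let $\Gamma$ be a graph. The cops and robbers game on $\Gamma$ has parameters: number of cops $n\in\mathbb{N}$, base point (treasure) $v\in\Gamma$ a vertex, cop speed $\sigma\in\mathbb{N}$, robber speed $\psi\in\mathbb{N}$, cop reach $\rho\in\mathbb{N}$, robber radius (also called robber reach) $R\in\mathbb{N}$. It is a two-player game with perfect information. First the cop player chooses $n$ vertices as starting positions of the cops, then the robber chooses a vertex as starting position. The players then alternate turns, starting with the cops. In each turn the cop player may move each cop along a path of length at most $\sigma$ to some vertex; then the robber moves along a path of length at most $\psi$ ending in a vertex. One cop move followed by one robber move is a stage.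 The cop player wins if the robber is captured, i.e. at some time during some stage the robber's position is at distance at most $\rho$ from some cop's position (this includes every vertex traversed by the robber during a move: the robber must traverse the path edge by edge without ever coming within distance $\rho$ of a cop), or if the cops eventually defend $v$, i.e. after some finite initial time the robber never enters the closed ball of radius $R$ around $v$. Otherwise the robber wins. The weak cop number $\operatorname{wCop}(\Gamma)\in\mathbb{N}\cup\{\infty\}$ is the infimum (with $\inf\emptyset=\infty$) of all $n\in\mathbb{N}$ such that $\forall v\in\Gamma,\ \exists\sigma\in\mathbb{N},\ \exists\rho\in\mathbb{N},\ \forall\psi\in\mathbb{N},\ \forall R\in\mathbb{N}$: the cop player has a winning strategy with $n$ cops. The strong cop number $\operatorname{sCop}(\Gamma)$ is defined in the same way with the quantifiers $\forall v\in\Gamma,\ \exists\sigma\in\mathbb{N},\ \forall\psi\in\mathbb{N},\ \exists\rho\in\mathbb{N},\ \forall R\in\mathbb{N}$. *)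

(* Defs.v *)
From HB Require Import structures.
From mathcomp Require Import all_boot all_order all_algebra.
From mathcomp Require Import boolp classical_sets reals constructive_ereal.
From mathcomp Require Import ereal topology.

Set Implicit Arguments.
Unset Strict Implicit.
Unset Printing Implicit Defensive.

Import Order.TTheory GRing.Theory Num.Theory.

Local Open Scope classical_set_scope.
Local Open Scope ring_scope.

(* Connected simple graphs, possibly infinite and not locally finite. *)
Record graph := Graph {
  vertex :> eqType;
  adj : rel vertex;
  adj_sym : symmetric adj;
  adj_irrefl : irreflexive adj;
  adj_connected : forall x y : vertex,
    exists p : seq vertex, path adj x p /\ last x p = y }.

Section Distance.
Variable G : graph.
Implicit Types x y : G.

(* As in [path], the starting vertex [x] is not listed in [p], so that [size p]
   is the number of edges; vertices may be repeated. *)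
Definition walk x y (p : seq G) := path (@adj G) x p /\ last x p = y.

Lemma ex_walk_size x y :
  exists n, `[< exists2 p, walk x y p & size p = n >].
Proof.
by have [p wp] := adj_connected x y; exists (size p); apply/asboolP; exists p.
Qed.

Definition gdist x y : nat := ex_minn (ex_walk_size x y).

End Distance.

Section Game.
Variables (G : graph) (n : nat).

Definition config := 'I_n -> G.

(* A stage records the positions of the cops after their move, and the walk
   taken by the robber in reply (without its starting vertex). *)
Definition stage := (config * seq G)%type.

Record history := History {
  hcops : config;
  hrobber : G;
  hstages : seq stage }.

Definition cops_at (h : history) : config :=
  last (hcops h) (unzip1 (hstages h)).

Definition robber_at (h : history) : G :=
  last (hrobber h) (flatten (unzip2 (hstages h))).

Record play := Play {
  pcops : config;
  probber : G;
  pstage : nat -> stage }.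

Definition history_of (p : play) (k : nat) : history :=
  History (pcops p) (probber p) (mkseq (pstage p) k).

(* All the vertices occupied by the robber during the (0-based) stage [k]. *)
Definition robber_visits (p : play) (k : nat) : seq G :=
  robber_at (history_of p k) :: (pstage p k).2.

Definition cops_move_ok (sigma : nat) (c c' : config) :=
  forall i, exists2 w, walk (c i) (c' i) w & (size w <= sigma)%N.

Definition robber_move_ok (psi : nat) (x : G) (w : seq G) :=
  path (@adj G) x w /\ (size w <= psi)%N.

Definition cops_legal (sigma : nat) (p : play) := forall k,
  cops_move_ok sigma (cops_at (history_of p k)) (pstage p k).1.

Definition robber_legal (psi : nat) (p : play) := forall k,
  robber_move_ok psi (robber_at (history_of p k)) (pstage p k).2.

(* A captured robber need not stop: a play is continued forever, and an early
   capture decides it in favour of the cops. *)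
Definition captured (rho : nat) (p : play) :=
  (exists i, (gdist (pcops p i) (probber p) <= rho)%N) \/
  (exists k i x, x \in robber_visits p k /\
     (gdist ((pstage p k).1 i) x <= rho)%N).

Definition defended (v : G) (R : nat) (p : play) :=
  exists N, forall k x, (N <= k)%N -> x \in robber_visits p k ->
    (R < gdist v x)%N.

Definition cops_win (v : G) (rho R : nat) (p : play) :=
  captured rho p \/ defended v R p.

(* Strategies prescribe a move at every history, reachable or not. Asking for
   admissible moves everywhere is harmless, as staying put is admissible. *)
Record cop_strategy := CopStrategy {
  cop_init : config;
  cop_move : history -> config }.

Record robber_strategy := RobberStrategy {
  robber_init : config -> G;
  robber_move : history -> config -> seq G }.

Definition cop_strategy_legal (sigma : nat) (S : cop_strategy) :=
  forall h, cops_move_ok sigma (cops_at h) (cop_move S h).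

Definition robber_strategy_legal (psi : nat) (T : robber_strategy) :=
  forall h c, robber_move_ok psi (robber_at h) (robber_move T h c).

Definition follows_cop (S : cop_strategy) (p : play) :=
  pcops p = cop_init S /\
  forall k, (pstage p k).1 = cop_move S (history_of p k).

Definition follows_robber (T : robber_strategy) (p : play) :=
  probber p = robber_init T (pcops p) /\
  forall k, (pstage p k).2 = robber_move T (history_of p k) (pstage p k).1.

Definition cops_have_winning_strategy (v : G) (sigma psi rho R : nat) :=
  exists2 S, cop_strategy_legal sigma S &
    forall p, follows_cop S p -> robber_legal psi p -> cops_win v rho R p.

Definition robber_has_winning_strategy (v : G) (sigma psi rho R : nat) :=
  exists2 T, robber_strategy_legal psi T &
    forall p, follows_robber T p -> cops_legal sigma p -> ~ cops_win v rho R p.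

End Game.

Definition weak_win (G : graph) (n : nat) :=
  forall v : G, exists2 sigma, (0 < sigma)%N & exists2 rho, (0 < rho)%N &
  forall psi, (0 < psi)%N -> forall R, (0 < R)%N ->
  cops_have_winning_strategy n v sigma psi rho R.

Definition strong_win (G : graph) (n : nat) :=
  forall v : G, exists2 sigma, (0 < sigma)%N &
  forall psi, (0 < psi)%N -> exists2 rho, (0 < rho)%N &
  forall R, (0 < R)%N ->
  cops_have_winning_strategy n v sigma psi rho R.

(* The positive integers together with infinity, inside the extended reals. *)
Definition pnatbar (K : realType) : set (\bar K) :=
  [set m | m = +oo%E \/ exists2 n, (0 < n)%N & m = (n%:R)%:E].

Definition wCop (K : realType) (G : graph) : \bar K :=
  ereal_inf [set (n%:R)%:E | n in [set n | (0 < n)%N /\ weak_win G n]].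

Definition sCop (K : realType) (G : graph) : \bar K :=
  ereal_inf [set (n%:R)%:E | n in [set n | (0 < n)%N /\ strong_win G n]].

Definition coarsely_surjective (K : realType) (D G : graph) (C : K)
    (f : D -> G) :=
  forall x : G, exists y : D, (gdist (f y) x)%:R <= C.

Definition quasi_homothety (K : realType) (D G : graph) (A B : K) (r : nat)
    (f : D -> G) :=
  forall x y : D,
    A^-1 * (gdist x y)%:R - B <= r%:R^-1 * (gdist (f x) (f y))%:R /\
    r%:R^-1 * (gdist (f x) (f y))%:R <= A * (gdist x y)%:R + B.

Definition quasi_homotheties (K : realType) (D : nat -> graph) (G : graph)
    (A B : K) (rho : nat -> nat) (iota : forall j, D j -> G) :=
  forall j, coarsely_surjective (A * (rho j)%:R + B) (iota j) /\
            quasi_homothety A B (rho j) (iota j).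

(* Main.v *)
Require Import Defs.
From HB Require Import structures.
From mathcomp Require Import all_boot all_order all_algebra.
From mathcomp Require Import boolp classical_sets reals constructive_ereal.
From mathcomp Require Import ereal topology.
From mathcomp Require Import zify.

(** A win of the robber on some [Delta j] is carried over to [Gamma] by slowing
    the game down: one stage on [Delta j] is played during [rho j] consecutive
    stages on [Gamma].  In that time a cop of [Gamma] runs at most
    [rho j * sigma] edges, which is a distance bounded independently of [j] once
    it is pulled back to [Delta j]; and the image of a robber move of [Delta j]
    has length at most a constant times [rho j], so that running a constant
    number of edges per stage suffices.

    What makes this fit the strong game is the order of the choices.  The cops
    announce their speed, which fixes the speed and reach of the shadow cops on
    [Delta j]; uniformity in [j] then gives a robber speed on all [Delta j], and
    hence one on [Gamma], before [j] is chosen.  Only after the cops have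
    announced their reach is [j] taken so large that [rho j] exceeds it: on the
    scale of [Delta j] that reach is then bounded.  The radius comes last and
    may depend on [j] and on the distance between the base vertices.

    As the cops would have to beat every play of the robber, no winning robber
    strategy on [Gamma] is built: it suffices to exhibit one play that follows
    the given cop strategy and that the cops do not win.  In it the robber uses
    the rule [shadow_robber], and the cops' positions at the stages divisible by
    [rho j], projected to [Delta j], are the moves in [shadow_play], a game on
    [Delta j] in which the robber follows his winning strategy.  The lemmas
    [shadow_cops_legal], [shadow_captured] and [shadow_defended] say that a win
    of the cops on [Gamma] would make them win [shadow_play];
    [no_cop_win_of_shadow] collects this, and the theorem is then the choice of
    the constants. *)

Set Implicit Arguments.
Unset Strict Implicit.
Unset Printing Implicit Defensive.

Import Order.TTheory GRing.Theory Num.Theory.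

(** * The path metric *)

Section GraphDistance.
Variable G : graph.
Implicit Types x y z : G.

Lemma gdist_leq_size x y p : walk x y p -> gdist x y <= size p.
Proof.
move=> wp; rewrite /gdist; case: ex_minnP => d _; apply.
by apply/asboolP; exists p.
Qed.

Lemma ex_geodesic x y : exists2 p, walk x y p & size p = gdist x y.
Proof. by rewrite /gdist; case: ex_minnP => d /asboolP. Qed.

Lemma gdist_leq_walk x y d :
  (exists2 p, walk x y p & size p <= d) -> gdist x y <= d.
Proof. by case=> p /gdist_leq_size; apply: leq_trans. Qed.

Lemma walk_of_gdist x y d :
  gdist x y <= d -> exists2 p, walk x y p & size p <= d.
Proof. by have [p wp <-] := ex_geodesic x y; exists p. Qed.

Lemma gdistxx x : gdist x x = 0.
Proof. by apply/eqP; rewrite -leqn0; apply: (@gdist_leq_size x x [::]). Qed.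

Lemma gdist_triangle z x y : gdist x y <= gdist x z + gdist z y.
Proof.
have [p [pp lp] <-] := ex_geodesic x z; have [q [pq lq] <-] := ex_geodesic z y.
rewrite -size_cat; apply: gdist_leq_size; split; last by rewrite last_cat lp.
by rewrite cat_path pp lp.
Qed.

Lemma gdist_sym x y : gdist x y = gdist y x.
Proof.
suff le_gdist (u v : G) : gdist u v <= gdist v u.
  by apply/eqP; rewrite eqn_leq !le_gdist.
have [p [pp <-] <-] := ex_geodesic v u.
have := rev_path (@adj G) v p; rewrite (eq_path (e' := @adj G)); last first.
  by move=> ? ?; rewrite adj_sym.
rewrite pp => rp; rewrite -(size_belast v) -size_rev.
apply: gdist_leq_size; split=> //.
by case: (p) => //= z q; rewrite rev_cons last_rcons.
Qed.

Lemma gdist_adj x y : adj x y -> gdist x y <= 1.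
Proof.
by move=> xy; apply: (@gdist_leq_size x y [:: y]); split=> //=; rewrite xy.
Qed.

Lemma gdist_path_mem x p z : path (@adj G) x p -> z \in p ->
  gdist x z <= size p.
Proof.
move=> pp zp; case/splitPr: zp pp => p1 p2; rewrite -cat_rcons cat_path.
case/andP=> pp1 _; rewrite size_cat.
apply: leq_trans (leq_addr _ _); apply: gdist_leq_size; split=> //.
by rewrite last_rcons.
Qed.

End GraphDistance.

(** * Plays generated by strategies *)

Section Plays.
Variables (G : graph) (n : nat).
Implicit Types (p : play G n) (S : cop_strategy G n) (T : robber_strategy G n).

Lemma history_ofS p k : history_of p k.+1 =
  History (pcops p) (probber p) (rcons (mkseq (pstage p) k) (pstage p k)).
Proof. by rewrite /history_of mkseqS. Qed.

Lemma robber_at_historyS p k : robber_at (history_of p k.+1) =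
  last (robber_at (history_of p k)) (pstage p k).2.
Proof.
by rewrite history_ofS /robber_at /= /unzip2 map_rcons flatten_rcons last_cat.
Qed.

Lemma cops_at_historyS p k : cops_at (history_of p k.+1) = (pstage p k).1.
Proof. by rewrite history_ofS /cops_at /= /unzip1 map_rcons last_rcons. Qed.

Lemma cops_gdist sigma p k l i : cops_legal sigma p ->
  gdist ((pstage p k).1 i) ((pstage p (k + l)).1 i) <= l * sigma.
Proof.
move=> legal; elim: l => [|l IHl]; first by rewrite addn0 gdistxx.
rewrite (leq_trans (gdist_triangle ((pstage p (k + l)).1 i) _ _)) //.
rewrite mulSn addnC leq_add // addnS.
by have /(_ i)/gdist_leq_walk := legal (k + l).+1; rewrite cops_at_historyS.
Qed.

(** A play cannot be defined directly by what the strategies prescribe, since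
    they read its initial segments; the histories are generated first. *)
Definition advance S T (h : history G n) : history G n :=
  let c := cop_move S h in
  History (hcops h) (hrobber h) (rcons (hstages h) (c, robber_move T h c)).

Definition match_history S T k :=
  let c := cop_init S in
  iter k (advance S T) (History c (robber_init T c) [::]).

Definition match_play S T : play G n :=
  Play (cop_init S) (robber_init T (cop_init S)) (fun k =>
    let h := match_history S T k in
    let c := cop_move S h in (c, robber_move T h c)).

Lemma history_of_match S T k :
  history_of (match_play S T) k = match_history S T k.
Proof.
elim: k => // k IHk; rewrite history_ofS.
rewrite [RHS]/match_history iterS -/(match_history S T k) -IHk /advance /=.
by rewrite IHk.
Qed.

Lemma ex_match S T : exists2 p, follows_cop S p & follows_robber T p.
Proof.
exists (match_play S T); (split; first by []).
  by move=> k; rewrite history_of_match.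
by move=> k; rewrite history_of_match.
Qed.

(** The reaction of a robber strategy to an explicit list of cop moves.  With a
    finite list it is evident that his past moves do not depend on later moves
    of the cops, which is what allows a robber on another graph to consult it. *)
Definition respond T (c0 : config G n) (cs : seq (config G n)) : history G n :=
  foldl (fun h c => History (hcops h) (hrobber h)
                      (rcons (hstages h) (c, robber_move T h c)))
    (History c0 (robber_init T c0) [::]) cs.

Definition respond_play T c0 (c : nat -> config G n) : play G n :=
  Play c0 (robber_init T c0)
    (fun k => (c k, robber_move T (respond T c0 (mkseq c k)) (c k))).

Lemma history_of_respond T c0 c k :
  history_of (respond_play T c0 c) k = respond T c0 (mkseq c k).
Proof.
elim: k => // k IHk; rewrite history_ofS mkseqS /respond foldl_rcons.
by rewrite -/(respond T c0 (mkseq c k)) -IHk /= IHk.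
Qed.

Lemma follows_respond T c0 c : follows_robber T (respond_play T c0 c).
Proof. by split=> // k; rewrite history_of_respond. Qed.

End Plays.

(** * Lifting walks *)

(** Quasi-homothety of ratio [r] with the constants rounded up to a single
    integer [a] and the inequalities cleared of denominators. *)
Definition scaled_map (a r : nat) (D G : graph) (f : D -> G) :=
  [/\ forall x : G, exists y : D, gdist (f y) x <= a * r,
      forall x y : D, gdist (f x) (f y) <= a * r * (gdist x y).+1
    & forall x y : D, r * gdist x y <= a * (gdist (f x) (f y) + a * r)].

(** Walks are carried along [f] by replacing each edge by a chosen segment. *)
Section Lift.
Variables (D G : graph) (f : D -> G) (seg : D -> D -> seq G).
Hypothesis segP : forall x y, walk (f x) (f y) (seg x y).

Fixpoint lift x w :=
  if w is y :: w' then seg x y ++ lift y w' else [::].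

Lemma lift_path x w : path (@adj G) (f x) (lift x w).
Proof.
elim: w x => //= y w IHw x; have [pseg lseg] := segP x y.
by rewrite cat_path pseg lseg IHw.
Qed.

Lemma last_lift x w : last (f x) (lift x w) = f (last x w).
Proof.
elim: w x => //= y w IHw x; have [_ lseg] := segP x y.
by rewrite last_cat lseg IHw.
Qed.

Lemma mem_lift x w y : y \in x :: w -> f y \in f x :: lift x w.
Proof.
elim: w x => [|z w IHw] x; first by rewrite /= !inE => /eqP->.
rewrite inE => /predU1P[->|/IHw]; first exact: mem_head.
have [_ lseg] := segP x z; rewrite /= -cat_cons mem_cat inE => /predU1P[->|->].
  by rewrite -lseg mem_last.
by rewrite orbT.
Qed.

Variable b : nat.
Hypothesis size_seg : forall x y, adj x y -> size (seg x y) <= b.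

Lemma size_lift x w : path (@adj D) x w -> size (lift x w) <= b * size w.
Proof.
elim: w x => [|y w IHw] x //= /andP[xy pw].
by rewrite size_cat mulnS leq_add ?size_seg ?IHw.
Qed.

Lemma lift_near x w z : path (@adj D) x w -> z \in f x :: lift x w ->
  exists2 y, y \in x :: w & gdist (f y) z <= b.
Proof.
move=> pw; rewrite inE => /predU1P[->|].
  by exists x; rewrite ?mem_head ?gdistxx.
elim: w x pw => [|y w IHw] x //= /andP[xy pw]; rewrite mem_cat => /orP[zs|].
  exists x; first exact: mem_head.
  have [ps _] := segP x y.
  by rewrite (leq_trans (gdist_path_mem ps zs)) ?size_seg.
by move=> /(IHw y pw)[u uw du]; exists u; rewrite // inE uw orbT.
Qed.

End Lift.

(** * Cutting a walk into moves *)

Section Chunks.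
Variable (A : eqType).
Implicit Types (W : seq A).

Definition chunk M s W := take M (drop (s * M) W).

Lemma take_chunkS M s W : take (s.+1 * M) W = take (s * M) W ++ chunk M s W.
Proof. by rewrite mulSn addnC takeD. Qed.

Lemma mem_take_chunk M s W z :
  z \in take (s * M) W -> exists2 t, t < s & z \in chunk M t W.
Proof.
elim: s => [|s IHs]; first by rewrite mul0n take0.
rewrite take_chunkS mem_cat => /orP[/IHs[t ts zt]|zs]; last by exists s.
by exists t; rewrite // ltnW.
Qed.

Lemma path_chunk (e : rel A) x M s W :
  path e x W -> path e (last x (take (s * M) W)) (chunk M s W).
Proof.
rewrite -{1}(cat_take_drop (s.+1 * M) W) take_chunkS -catA cat_path.
by case/andP=> _; rewrite cat_path => /andP[].
Qed.

End Chunks.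

(** * The shadow game *)

Section Shadow.
Variables (D G : graph) (f : D -> G) (a r n : nat).
Hypotheses (f_scaled : scaled_map a r f) (r_gt0 : 0 < r).
Variables (T : robber_strategy D n) (psi : nat).
Hypothesis T_legal : robber_strategy_legal psi T.

Variable g : G -> D.
Hypothesis gP : forall x, gdist (f (g x)) x <= a * r.
Variable seg : D -> D -> seq G.
Hypothesis segP : forall x y, walk (f x) (f y) (seg x y).
Hypothesis size_seg : forall x y, size (seg x y) = gdist (f x) (f y).

Local Notation psi' := (2 * a * psi).

Definition shadow (c : config G n) : config D n := g \o c.

Lemma shadow_close c i : gdist (f (shadow c i)) (c i) <= a * r.
Proof. exact: gP. Qed.

(** At stage [k] the number of completed blocks of [r] stages is [k %/ r], and
    the cop positions relevant to the shadow game are those just after the cops'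
    move at the first stage of each block.  The current one is known to the
    robber from the start of the block on, so he can spread the lift of his
    reply over all of it. *)
Definition shadow_robber : robber_strategy G n :=
  RobberStrategy (fun c => f (robber_init T (shadow c))) (fun h c =>
    let k := size (hstages h) in
    let cs := rcons (unzip1 (hstages h)) c in
    let sh l := shadow (nth c cs (l * r)) in
    let d := respond T (shadow (hcops h)) (mkseq sh (k %/ r)) in
    chunk psi' (k %% r)
      (lift seg (robber_at d) (robber_move T d (sh (k %/ r))))).

Variable p : play G n.
Hypothesis p_robber : follows_robber shadow_robber p.

Let C k := (pstage p k).1.

Definition shadow_play : play D n :=
  respond_play T (shadow (pcops p)) (fun l => shadow (C (l * r))).

Let X q := robber_at (history_of shadow_play q).
Let w q := (pstage shadow_play q).2.
Let W q := lift seg (X q) (w q).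

Lemma reply_legal q : robber_move_ok psi (X q) (w q).
Proof. by rewrite /w (follows_respond _ _ _).2; apply: T_legal. Qed.

Lemma size_seg_adj x y : adj x y -> size (seg x y) <= 2 * a * r.
Proof.
move=> xy; have [_ /(_ x y) fxy _] := f_scaled; rewrite size_seg.
apply: leq_trans fxy _; rewrite -(mulnA 2) [leqRHS]mulnC leq_mul2l.
by rewrite ltnS gdist_adj ?orbT.
Qed.

(** This is why the speed [2 * a * psi] suffices: [r] moves cover the lift. *)
Lemma size_W q : size (W q) <= r * psi'.
Proof.
apply: leq_trans (size_lift size_seg_adj (reply_legal q).1) _.
apply: leq_trans (leq_mul (leqnn _) (reply_legal q).2) _.
lia.
Qed.

Lemma take_W q : take (r * psi') (W q) = W q.
Proof. by rewrite take_oversize ?size_W. Qed.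

Lemma pstage_chunk q s : s < r -> (pstage p (q * r + s)).2 = chunk psi' s (W q).
Proof.
move=> sr; have [_ ->] := p_robber; rewrite /= size_mkseq.
rewrite divnMDl // divn_small // addn0 modnMDl modn_small //.
set k := q * r + s.
(* The sampled stages precede [k], so that the list read by the strategy and
   the whole play give the same shadow moves. *)
set cs := rcons _ _.
have -> : cs = mkseq C k.+1 by rewrite /cs mkseqS /unzip1 /mkseq -map_comp.
have nthC l : l <= q -> nth (C k) (mkseq C k.+1) (l * r) = C (l * r).
  move=> lq; rewrite nth_mkseq // ltnS (leq_trans _ (leq_addr _ _)) //.
  by rewrite leq_mul2r lq orbT.
rewrite nthC //; set sh := mkseq _ q.
have -> : sh = mkseq (fun l => shadow (C (l * r))) q.
  by apply/eq_in_map => l; rewrite mem_iota => /andP[_ /ltnW lq]; rewrite nthC.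
by rewrite /W /X history_of_respond.
Qed.

Lemma robber_at_shadow q s : s <= r ->
  robber_at (history_of p (q * r + s)) = last (f (X q)) (take (s * psi') (W q)).
Proof.
elim: q s => [|q IHq]; elim=> [|s IHs] sr.
- by rewrite take0 /X /robber_at /=; have [->] := p_robber.
- rewrite addnS robber_at_historyS IHs 1?ltnW // pstage_chunk //.
  by rewrite take_chunkS last_cat.
- rewrite addn0 mulSn addnC IHq // take0 take_W /W last_lift //.
  by rewrite /X robber_at_historyS.
rewrite addnS robber_at_historyS IHs 1?ltnW // pstage_chunk //.
by rewrite take_chunkS last_cat.
Qed.

Lemma shadow_robber_legal : robber_legal psi' p.
Proof.
move=> k; rewrite (divn_eq k r); have sr := ltn_pmod k r_gt0.
rewrite robber_at_shadow 1?ltnW // pstage_chunk //; split.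
  exact/path_chunk/lift_path.
by rewrite size_take_min geq_minl.
Qed.

(** During a whole block the robber stays close to the image of the one move
    that he makes in the shadow game. *)
Lemma shadow_near q s z : s < r -> z \in robber_visits p (q * r + s) ->
  exists2 y, y \in robber_visits shadow_play q & gdist (f y) z <= 2 * a * r.
Proof.
move=> sr zp; apply: (lift_near segP size_seg_adj (reply_legal q).1).
rewrite -/(W q); move: zp; rewrite /robber_visits robber_at_shadow 1?ltnW //.
rewrite pstage_chunk // in_cons.
case/predU1P=> [->|/mem_take/mem_drop]; last by rewrite inE orbC => ->.
by have := mem_last (f (X q)) (take (s * psi') (W q)); rewrite !inE
  => /orP[->|/mem_take->] //; rewrite orbT.
Qed.

Lemma shadow_visits q y : y \in robber_visits shadow_play q ->
  exists2 k, q * r <= k & f y \in robber_visits p k.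
Proof.
move=> yq; have := mem_lift segP yq; rewrite inE => /predU1P[->|].
  exists (q * r) => //; rewrite /robber_visits inE.
  have := robber_at_shadow q (leq0n r).
  by rewrite addn0 take0 => ->; rewrite eqxx.
rewrite -/(X q) -/(w q) -/(W q) -take_W => /mem_take_chunk[s sr ys].
exists (q * r + s); first exact: leq_addr.
by rewrite /robber_visits pstage_chunk // inE ys orbT.
Qed.

Lemma gdist_shadow b x y : gdist (f x) (f y) <= b * r ->
  gdist x y <= a * (b + a).
Proof.
move=> fxy; have [_ _ /(_ x y) xy] := f_scaled.
rewrite -(leq_pmul2l r_gt0) (leq_trans xy) // mulnCA leq_mul2l.
by apply/orP; right; rewrite mulnDr (mulnC r b) (mulnC r a) leq_add2r.
Qed.

Variable sigma : nat.
Hypothesis p_cops : cops_legal sigma p.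

(** A cop runs at most [r * sigma] in a block, and passing to the image of its
    shadow costs at most [a * r] at each end. *)
Lemma shadow_cops_legal : cops_legal (a * (3 * a + sigma)) shadow_play.
Proof.
have step x y : gdist x y <= r * sigma ->
    gdist (g x) (g y) <= a * (3 * a + sigma).
  move=> xy; have -> : 3 * a + sigma = 2 * a + sigma + a by lia.
  apply: gdist_shadow; have := gP x; have := gP y.
  have := gdist_triangle x (f (g x)) (f (g y)).
  have := gdist_triangle y x (f (g y)); rewrite (gdist_sym y); nia.
move=> k i; apply: walk_of_gdist; case: k => [|k].
  (* The first sample is taken one move after the initial position. *)
  apply: step; have /(_ i)/gdist_leq_walk := p_cops 0; rewrite mul0n => d1.
  by apply: leq_trans d1 _; rewrite leq_pmull.
rewrite cops_at_historyS; apply: step; rewrite mulSn addnC.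
exact: cops_gdist.
Qed.

(** In units of [r], the distance between the images of a shadow cop and of a
    vertex of the shadow robber's move is at most [a] (cop to its shadow), plus
    [sigma] (motion of the cop since the start of the block), plus [1] (reach),
    plus [2 * a] (robber to the image of his shadow's move). *)
Lemma shadow_captured rho : rho <= r ->
  captured rho p -> captured (a * (4 * a + sigma + 1)) shadow_play.
Proof.
move=> rr; have -> : 4 * a + sigma + 1 = 3 * a + sigma + 1 + a by lia.
case=> [[i]|[k [i [z []]]]].
  have [-> _] := p_robber => /= ci; left; exists i; apply: gdist_shadow.
  apply: leq_trans (gdist_triangle (pcops p i) _ _) _.
  apply: leq_trans (leq_add (shadow_close _ i) (leq_trans ci rr)) _; nia.
rewrite (divn_eq k r); have sr := ltn_pmod k r_gt0.
move: (k %/ r) (k %% r) sr => q s sr /(shadow_near sr)[y yq yz] ci.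
right; exists q, i, y; split=> //; apply: gdist_shadow => /=.
have := cops_gdist (q * r) s i p_cops; rewrite -!/(C _) in ci *.
have := shadow_close (C (q * r)) i.
have := gdist_triangle (C (q * r) i) (f (shadow (C (q * r)) i)) (f y).
have := gdist_triangle (C (q * r + s) i) (C (q * r) i) (f y).
have := gdist_triangle z (C (q * r + s) i) (f y).
rewrite (gdist_sym z).
have : s * sigma <= r * sigma by rewrite leq_mul2r ltnW ?orbT.
nia.
Qed.

(** The lifted walk passes through the image of every vertex that the shadow
    robber visits, so each of his returns near [v] is seen near [u]. *)
Lemma shadow_defended u v R :
  defended u (gdist u (f v) + a * r * R.+1) p -> defended v R shadow_play.
Proof.
case=> N defN; exists N => q y Nq /shadow_visits[k qk /(defN k)].
have /[swap]/[apply] : N <= k.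
  by apply: leq_trans qk; apply: leq_trans Nq (leq_pmulr _ _).
rewrite !ltnNge; apply: contra => vy.
apply: leq_trans (gdist_triangle (f v) _ _) _; rewrite leq_add2l.
have [_ /(_ v y) fvy _] := f_scaled; apply: leq_trans fvy _.
by rewrite leq_mul2l ltnS vy orbT.
Qed.

End Shadow.

Lemma no_cop_win_of_shadow (D G : graph) (f : D -> G)
  (a r n sigma psi rho R : nat) (u : G) (v : D) :
  scaled_map a r f -> 0 < r -> rho <= r ->
  robber_has_winning_strategy n v
    (a * (3 * a + sigma)) psi (a * (4 * a + sigma + 1)) R ->
  ~ cops_have_winning_strategy n u sigma (2 * a * psi) rho
      (gdist u (f v) + a * r * R.+1).
Proof.
move=> f_scaled r_gt0 rho_r [T T_legal T_wins] [S S_legal S_wins].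
have [/choice[g gP] _ _] := f_scaled.
have /choice[seg segP] (xy : D * D) : exists s,
    walk (f xy.1) (f xy.2) s /\ size s = gdist (f xy.1) (f xy.2).
  by have [s] := ex_geodesic (f xy.1) (f xy.2); exists s.
pose seg2 x y := seg (x, y).
have seg2P x y : walk (f x) (f y) (seg2 x y) by case: (segP (x, y)).
have size_seg2 x y : size (seg2 x y) = gdist (f x) (f y) by case: (segP (x, y)).
have [p pS pT] := ex_match S (shadow_robber f a r T psi g seg2).
have p_legal : cops_legal sigma p by move=> k; rewrite pS.2.
apply: (T_wins (shadow_play r T g p)).
- exact: follows_respond.
- exact: (shadow_cops_legal f_scaled r_gt0 T gP p_legal).
have := S_wins p pS
  (shadow_robber_legal f_scaled r_gt0 T_legal seg2P size_seg2 pT).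
case=> [cap|def]; [left|right].
  exact: (shadow_captured f_scaled r_gt0 T_legal gP seg2P size_seg2 pT
    p_legal rho_r cap).
exact: (shadow_defended f_scaled r_gt0 T_legal seg2P size_seg2 pT def).
Qed.

(** * From quasi-homotheties to the cop number *)

Local Open Scope classical_set_scope.
Local Open Scope ring_scope.

Lemma quasi_homothety_scaled (K : realType) (D G : graph) (A B : K) (a r : nat)
  (f : D -> G) :
  1 <= A -> 0 <= B -> A + B <= a%:R -> (0 < r)%N ->
  coarsely_surjective (A * r%:R + B) f -> quasi_homothety A B r f ->
  scaled_map a r f.
Proof.
move=> A1 B0 ABa r_gt0 f_surj f_qh.
have A_gt0 : 0 < A by apply: lt_le_trans A1.
have r1 : 1 <= r%:R :> K by rewrite ler1n.
have r0 : 0 < r%:R :> K by rewrite ltr0n.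
have Aa : A <= a%:R by apply: le_trans ABa; rewrite lerDl.
have Ba : B <= a%:R by apply: le_trans ABa; rewrite lerDr ltW.
split=> [x|x y|x y].
- have [y yx] := f_surj x; exists y.
  rewrite -(ler_nat K) (le_trans yx) // natrM.
  apply: (@le_trans _ _ ((A + B) * r%:R)); last by rewrite ler_wpM2r // ltW.
  by rewrite mulrDl lerD2l ler_peMr.
- have [_] := f_qh x y; rewrite mulrC ler_pdivrMr // => fxy.
  rewrite -(ler_nat K) (le_trans fxy) // 2!natrM -natr1 mulrAC.
  by rewrite ler_wpM2r ?(ltW r0) // mulrDr mulr1 lerD // ler_wpM2r.
have [+ _] := f_qh x y; rewrite lerBlDr ler_pdivrMl // => fxy.
rewrite -(ler_nat K) !(natrM, natrD).
apply: (@le_trans _ _ (r%:R * (A * (r%:R^-1 * (gdist (f x) (f y))%:R + B)))).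
  by rewrite ler_wpM2l // ltW.
rewrite mulrCA mulrDr mulVKf ?gt_eqF // mulrC [leRHS]mulrC.
apply: ler_pM => //; first by rewrite addr_ge0 // mulr_ge0 // ltW.
  exact: ltW.
by rewrite lerD2l mulrC ler_wpM2r // ltW.
Qed.

Theorem theorem4p5 (K : realType) (Delta : nat -> graph) (m : \bar K)
  (m_pnatbar : pnatbar m)
  (wCop_Delta : forall j, (m <= wCop K (Delta j))%E)
  (robber_uniform : forall n : nat, (0 < n)%N -> (n%:R%:E < m)%E ->
    forall sigma rho : nat, (0 < sigma)%N -> (0 < rho)%N ->
    exists psi R : nat, [/\ (0 < psi)%N, (0 < R)%N &
      forall j, exists v : Delta j,
        robber_has_winning_strategy n v sigma psi rho R])
  (A B : K) (A_ge1 : 1 <= A) (B_ge0 : 0 <= B)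
  (rho : nat -> nat) (rho_gt0 : forall j, (0 < rho j)%N)
  (rho_infty : rho @ \oo --> \oo)
  (Gamma : graph) (iota : forall j, Delta j -> Gamma)
  (iota_qh : quasi_homotheties A B rho iota) :
  (m <= sCop K Gamma)%E.
Proof.
apply: le_ereal_inf_tmp => _ [n [n_gt0 n_wins] <-].
rewrite leNgt; apply/negP => n_lt_m.
have uniform := robber_uniform n n_gt0 n_lt_m.
(* A base vertex of [Gamma], which could a priori be empty. *)
have [u] : exists u : Gamma, True.
  have [_ [_ [_ _ /(_ 0%N)[v _]]]] := uniform 1%N 1%N isT isT.
  by exists (iota 0%N v).
move=> _; have [sigma sigma_gt0 sigma_wins] := n_wins u.
pose a := (Num.truncn (A + B)).+1.
have a_ge : A + B <= a%:R by rewrite ltW ?truncnS_gt.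
have [||psi [R [psi_gt0 _ robber_wins]]] :=
  uniform (a * (3 * a + sigma))%N (a * (4 * a + sigma + 1))%N;
  rewrite ?muln_gt0 //.
have [|rc _ rc_wins] := sigma_wins (2 * a * psi)%N; first by rewrite !muln_gt0.
have [j rc_le] : exists j, (rc <= rho j)%N.
  have /cvgnyPge/(_ rc)[N _ rcN] := rho_infty.
  by exists N; apply: rcN => /=.
have [f_surj f_qh] := iota_qh j; have [v v_wins] := robber_wins j.
have f_scaled : scaled_map a (rho j) (iota j).
  exact: quasi_homothety_scaled f_qh.
apply: (no_cop_win_of_shadow f_scaled (rho_gt0 j) rc_le v_wins).
by apply: rc_wins; rewrite addn_gt0 !muln_gt0 rho_gt0 orbT.
Qed.
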